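(* Let $A$ be a quasipotent group and let $B$ be a subgroup of $A$ such that $A$ is $B$-separable, that is, $B$ is the intersection of finite index subgroups of $A$. Let $I$ be a finite set and let $\varphi_i : A \to A_i$, $i \in I$, be group isomorphisms. Put $B_i = \varphi_i(B)$ for $i\in I$, and $\varphi_{jk} = \varphi_j \varphi_k^{-1}$ for $j,k\in I$, $j \ne k$ (so that $\varphi_{jk}$ restricts to an isomorphism $B_k \to B_j$). Let $G$ be the free product of the groups $A_i$, $i \in I$, with the subgroups $B_i$ amalgamated via these isomorphisms, i.e. the quotient of the free product of the $A_i$ by the relations $b = \varphi_{jk}(b)$ for all $j \neq k$ in $I$ and all $b \in B_k$. Then $G$ is quasipotent.
   Context: A group $G$ is called quasipotent if for each element $g \in G$ there exists a natural number $k\ge 1$ such that for each natural number $n\ge 1$ there exists a finite index subgroup $H_n \leqslant G$ with $\langle g\rangle \cap H_n = \langle g^{kn}\rangle$. The composition $\varphi_j\varphi_k^{-1}$ means: first apply $\varphi_k^{-1}$, then $\varphi_j$. *)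

(* Defs.v *)
(* MathComp: groupType carries arbitrary, possibly infinite, groups. *)
From HB Require Import structures.
From mathcomp Require Import all_boot.
From mathcomp Require Import monoid generic_quotient.
From mathcomp Require Import boolp classical_sets cardinality.

Set Implicit Arguments.
Unset Strict Implicit.
Unset Printing Implicit Defensive.

Local Open Scope classical_set_scope.
Local Open Scope group_scope.
Local Open Scope quotient_scope.

Section Subgroups.
Variable G : groupType.
Implicit Types (g x y : G) (H R : set G).

Definition subgroup H :=
  [/\ H 1, (forall x y, H x -> H y -> H (x * y)) & (forall x, H x -> H x^-1)].

Definition normal_subgroup H :=
  subgroup H /\ (forall x y, H x -> H (y^-1 * (x * y))).

Definition lcoset x H : set G := [set x * h | h in H].

Definition finite_index H := finite_set [set lcoset x H | x in [set: G]].

Definition cyclic_subgroup g : set G :=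
  [set g ^+ n | n in [set: nat]] `|` [set g ^- n | n in [set: nat]].

Definition normal_closure R : set G :=
  \bigcap_(N in [set N | normal_subgroup N /\ R `<=` N]) N.

Definition separable H :=
  exists F : set (set G),
    (forall K, F K -> subgroup K /\ finite_index K) /\ H = \bigcap_(K in F) K.

Definition quasipotent :=
  forall g, exists2 k : nat, (0 < k)%N &
  forall n : nat, (0 < n)%N ->
  exists H, [/\ subgroup H, finite_index H &
    cyclic_subgroup g `&` H = cyclic_subgroup (g ^+ (k * n)%N)].

Lemma normal_closure_normal R : normal_subgroup (normal_closure R).
Proof.
split; first split.
- by move=> N [[[N1 _ _] _] _].
- move=> x y Nx Ny N NP; case: (NP) => [[[_ NM _] _] _].
  by apply: NM; [apply: Nx | apply: Ny].
- by move=> x Nx N NP; case: (NP) => [[[_ _ NV] _] _]; apply: NV; apply: Nx.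
- by move=> x y Nx N NP; case: (NP) => [[_ NJ] _]; apply: NJ; apply: Nx.
Qed.

End Subgroups.

Arguments quasipotent : clear implicits.

(* The quotient of G by the relations r = 1, r in R. *)
Section Quotient.
Variables (G : groupType) (R : set G).
Let N := normal_closure R.

Definition quotient_rel (x y : G) : bool := `[< N (x^-1 * y) >].

Fact quotient_rel_equiv : equiv_class_of quotient_rel.
Proof.
have [[N1 NM NV] _] := normal_closure_normal R.
split=> [x|x y|y x z].
- by apply/asboolP; rewrite mulVg.
- by apply/asboolP/asboolP => /NV; rewrite invgM invgK.
- move=> /asboolP Nxy /asboolP Nyz; apply/asboolP.
  by have := NM _ _ Nxy Nyz; rewrite -mulgA mulVKg.
Qed.

Canonical quotient_equiv := EquivRelPack quotient_rel_equiv.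

Definition quotient_group : Type := {eq_quot quotient_rel}.
HB.instance Definition _ := Choice.on quotient_group.
HB.instance Definition _ := EqQuotient.on quotient_group.

Definition quotient_proj (x : G) : quotient_group := \pi x.
Definition quotient_one : quotient_group := quotient_proj 1.
Definition quotient_mul (x y : quotient_group) : quotient_group :=
  quotient_proj (repr x * repr y).
Definition quotient_inv (x : quotient_group) : quotient_group :=
  quotient_proj (repr x)^-1.

Lemma quotient_projP x y : quotient_proj x = quotient_proj y <-> N (x^-1 * y).
Proof.
by split => [/eqP|Nxy]; [|apply/eqP]; rewrite eqmodE;
  [move/asboolP | apply/asboolP].
Qed.

Lemma quotient_projM x y :
  quotient_proj (x * y) = quotient_mul (quotient_proj x) (quotient_proj y).
Proof.
have [[N1 NM NV] NJ] := normal_closure_normal R.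
rewrite /quotient_mul; set x' := repr (_ x); set y' := repr (_ y).
have /quotient_projP Nx : quotient_proj x = quotient_proj x'.
  by rewrite {2}/quotient_proj reprK.
have /quotient_projP Ny : quotient_proj y = quotient_proj y'.
  by rewrite {2}/quotient_proj reprK.
apply/quotient_projP; have := NM _ _ (NJ _ y Nx) Ny.
by rewrite invgM -!mulgA mulVKg.
Qed.

Lemma quotient_projV x :
  quotient_proj x^-1 = quotient_inv (quotient_proj x).
Proof.
have [[N1 NM NV] NJ] := normal_closure_normal R.
rewrite /quotient_inv; set x' := repr (_ x).
have /quotient_projP Nx : quotient_proj x = quotient_proj x'.
  by rewrite {2}/quotient_proj reprK.
apply/quotient_projP; have := NV _ (NJ _ x^-1 Nx).
by rewrite !invgK -mulgA mulVKg invgM invgK.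
Qed.

Lemma quotient_projK (x : quotient_group) : quotient_proj (repr x) = x.
Proof. exact: reprK. Qed.

Fact quotient_mulA : associative quotient_mul.
Proof.
move=> x y z; rewrite -[x]quotient_projK -[y]quotient_projK.
by rewrite -[z]quotient_projK -!quotient_projM mulgA.
Qed.
Fact quotient_mul1g : left_id quotient_one quotient_mul.
Proof.
by move=> x; rewrite -[x]quotient_projK -!quotient_projM mul1g.
Qed.
Fact quotient_mulg1 : right_id quotient_one quotient_mul.
Proof.
by move=> x; rewrite -[x]quotient_projK -!quotient_projM mulg1.
Qed.
Fact quotient_mulVg : left_inverse quotient_one quotient_inv quotient_mul.
Proof.
move=> x; rewrite -[x]quotient_projK -quotient_projV -!quotient_projM.
by rewrite mulVg.
Qed.
Fact quotient_mulgV : right_inverse quotient_one quotient_inv quotient_mul.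
Proof.
move=> x; rewrite -[x]quotient_projK -quotient_projV -!quotient_projM.
by rewrite mulgV.
Qed.

HB.instance Definition _ := isGroup.Build quotient_group
  quotient_mulA quotient_mul1g quotient_mulg1 quotient_mulVg quotient_mulgV.

Fact quotient_proj_morph : {morph quotient_proj : x y / x * y}.
Proof. exact: quotient_projM. Qed.

HB.instance Definition _ :=
  isMultiplicative.Build G quotient_group quotient_proj quotient_proj_morph.

End Quotient.

(* Words in the disjoint union of the A_i, modulo the congruence generated by
   [1_(A_i)] ~ [] and [x; y] ~ [xy] for x, y in the same A_i. *)
Section FreeProduct.
Variables (I : choiceType) (A_ : I -> groupType).

Definition letter := {i : I & A_ i}.
Definition word := seq letter.

HB.instance Definition _ := Choice.on letter.
HB.instance Definition _ := Choice.on word.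

Definition letter_of i (x : A_ i) : letter := Tagged (fun i : I => A_ i) x.

Inductive word_cong : word -> word -> Prop :=
| word_cong_one i : word_cong [:: letter_of (1 : A_ i)] [::]
| word_cong_mul i (x y : A_ i) :
    word_cong [:: letter_of x; letter_of y] [:: letter_of (x * y)]
| word_cong_refl u : word_cong u u
| word_cong_sym u v : word_cong u v -> word_cong v u
| word_cong_trans u v w : word_cong u v -> word_cong v w -> word_cong u w
| word_cong_cat u u' v v' :
    word_cong u u' -> word_cong v v' -> word_cong (u ++ v) (u' ++ v').

Definition word_inv (u : word) : word :=
  rev [seq letter_of (tagged l : A_ (tag l))^-1 | l : letter <- u].

Definition word_rel (u v : word) : bool := `[< word_cong u v >].

Fact word_rel_equiv : equiv_class_of word_rel.
Proof.
split=> [u|u v|v u w].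
- exact/asboolP/word_cong_refl.
- by apply/asboolP/asboolP => /word_cong_sym.
- move=> /asboolP uv /asboolP vw.
  exact/asboolP/(word_cong_trans uv vw).
Qed.

Canonical word_equiv := EquivRelPack word_rel_equiv.

Definition free_product : Type := {eq_quot word_rel}.
HB.instance Definition _ := Choice.on free_product.
HB.instance Definition _ := EqQuotient.on free_product.

Definition fp_class (u : word) : free_product := \pi u.
Definition fp_one : free_product := fp_class [::].
Definition fp_mul (x y : free_product) : free_product :=
  fp_class (repr x ++ repr y).
Definition fp_inv (x : free_product) : free_product :=
  fp_class (word_inv (repr x)).

Lemma fp_classP u v : fp_class u = fp_class v <-> word_cong u v.
Proof.
by split => [/eqP|uv]; [|apply/eqP]; rewrite eqmodE;
  [move/asboolP | apply/asboolP].
Qed.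

Lemma fp_classK x : fp_class (repr x) = x.
Proof. exact: reprK. Qed.

Lemma word_cong_inv u v : word_cong u v -> word_cong (word_inv u) (word_inv v).
Proof.
elim=> {u v} [i|i x y|u|u v _|u v w _ uv _|u u' v v' _ uu' _ vv'].
- by rewrite /word_inv /= invg1; apply: word_cong_one.
- by rewrite /word_inv /= /rev /= invgM; apply: word_cong_mul.
- exact: word_cong_refl.
- exact: word_cong_sym.
- exact: word_cong_trans.
- by rewrite /word_inv !map_cat !rev_cat; apply: word_cong_cat.
Qed.

Lemma word_cong_mulVg u : word_cong (word_inv u ++ u) [::].
Proof.
elim: u => [|[i x] u IHu]; first exact: word_cong_refl.
rewrite /word_inv /= rev_cons -cats1 -catA -cat1s catA -[_ :: u]cat1s.
rewrite -catA [X in _ ++ X]catA; apply: word_cong_trans IHu.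
apply: word_cong_cat; first exact: word_cong_refl.
rewrite -[X in word_cong _ X]cat0s; apply: word_cong_cat; last first.
  exact: word_cong_refl.
apply: word_cong_trans (word_cong_mul _ _) _; rewrite mulVg.
exact: word_cong_one.
Qed.

Lemma word_invK : involutive word_inv.
Proof.
move=> u; rewrite /word_inv map_rev revK -map_comp -[RHS]map_id.
by apply: eq_map => -[i x] /=; rewrite invgK.
Qed.

Lemma fp_class_cat u v : fp_class (u ++ v) = fp_mul (fp_class u) (fp_class v).
Proof.
by apply/fp_classP/word_cong_cat; apply/fp_classP; rewrite fp_classK.
Qed.

Lemma fp_class_inv u : fp_class (word_inv u) = fp_inv (fp_class u).
Proof.
by apply/fp_classP/word_cong_inv; apply/fp_classP; rewrite fp_classK.
Qed.

Fact fp_mulA : associative fp_mul.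
Proof.
move=> x y z; rewrite -[x]fp_classK -[y]fp_classK -[z]fp_classK.
by rewrite -!fp_class_cat catA.
Qed.
Fact fp_mul1g : left_id fp_one fp_mul.
Proof. by move=> x; rewrite -[x]fp_classK -!fp_class_cat. Qed.
Fact fp_mulg1 : right_id fp_one fp_mul.
Proof. by move=> x; rewrite -[x]fp_classK -!fp_class_cat cats0. Qed.
Fact fp_mulVg : left_inverse fp_one fp_inv fp_mul.
Proof.
move=> x; rewrite -[x]fp_classK -fp_class_inv -!fp_class_cat.
exact/fp_classP/word_cong_mulVg.
Qed.
Fact fp_mulgV : right_inverse fp_one fp_inv fp_mul.
Proof.
move=> x; rewrite -[x]fp_classK -fp_class_inv -!fp_class_cat.
apply/fp_classP; rewrite -{1}[repr x]word_invK; exact: word_cong_mulVg.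
Qed.

HB.instance Definition _ := isGroup.Build free_product
  fp_mulA fp_mul1g fp_mulg1 fp_mulVg fp_mulgV.

Definition fp_inj i (x : A_ i) : free_product := fp_class [:: letter_of x].

Fact fp_inj_morph i : {morph @fp_inj i : x y / x * y}.
Proof.
move=> x y; rewrite [RHS]/mul /= -fp_class_cat.
exact/fp_classP/word_cong_sym/word_cong_mul.
Qed.

HB.instance Definition _ i :=
  isMultiplicative.Build (A_ i) free_product (@fp_inj i) (@fp_inj_morph i).

End FreeProduct.

(* The quotient of the free product of the A_i by the relations
   b = phi_jk(b), for j <> k and b in B_k. *)
Section Amalgam.
Variables (I : choiceType) (A_ : I -> groupType) (B_ : forall i, set (A_ i)).
Variable phi_ : forall j k, A_ k -> A_ j.

Definition amalgam_relators : set (free_product A_) :=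
  [set r | exists j k (b : A_ k),
     [/\ j <> k, B_ b & r = fp_inj b * (fp_inj (phi_ j b))^-1]].

Definition amalgamated_product : groupType := quotient_group amalgam_relators.

End Amalgam.

(* Main.v *)
(* Folding all factors onto A gives a homomorphism G -> A that is injective on
   each factor, so the conjugates of elements of the factors inherit
   quasipotency from A. Any other element is conjugate to a cyclically reduced
   word a_0 ... a_(r-1) of length r > 1, with a_t in the i_t-th copy of A and
   outside B. For such a word k = 1 works: separate the a_t from B in a finite
   image F of A by a subgroup D containing the image of B, and let G permute
   Z/nr x F, the i-th factor acting by right multiplication conjugated by an
   involution swap_i that commutes with D. The involutions are chosen so that
   the letter a_t carries (t, 1) to (t + 1, 1), where letters are repeated with
   period r; hence the word moves (0, 1) along a cycle of length exactly n. The
   stabilizer of (0, 1) has the required intersection with the cyclic group. *)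
From mathcomp Require Import all_boot.
From mathcomp Require Import fingroup perm.
From mathcomp Require Import monoid generic_quotient.
From mathcomp Require Import finmap.
From mathcomp Require Import boolp classical_sets cardinality.
Require Import Defs.

Local Open Scope classical_set_scope.

Set Implicit Arguments.
Unset Strict Implicit.
Unset Printing Implicit Defensive.

Local Open Scope group_scope.

(** * Subgroups of finite index, separability and cuts of cyclic groups *)

Section Subgroups.
Variable G : groupType.
Implicit Types (g x : G) (H K : set G).

Lemma subgroupX H x n : subgroup H -> H x -> H (x ^+ n).
Proof.
by move=> [H1 HM _] Hx; elim: n => [|n IHn]; rewrite ?expg0 ?expgS//; apply: HM.
Qed.

Lemma cyclic_subgroupXn g n : cyclic_subgroup g (g ^+ n).
Proof. by left; exists n. Qed.

Lemma cyclic_subgroup_sub H g :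
  subgroup H -> H g -> cyclic_subgroup g `<=` H.
Proof.
move=> sH Hg _ [[n _ <-]|[n _ <-]]; first exact: subgroupX.
by case: (sH) => _ _; apply; apply: subgroupX.
Qed.

Lemma cyclic_subgroupV g x : cyclic_subgroup g x^-1 -> cyclic_subgroup g x.
Proof.
move=> [[n _ e]|[n _ e]].
  by right; exists n; rewrite // e invgK.
by left; exists n => //; apply: invg_inj.
Qed.

Lemma cyclic_subgroupX_sub g n :
  cyclic_subgroup (g ^+ n) `<=` cyclic_subgroup g.
Proof.
move=> _ [[m _ <-]|[m _ <-]]; rewrite -expgnA; first exact: cyclic_subgroupXn.
by right; exists (n * m)%N.
Qed.

(* Restricting to nonnegative powers spares the sign cases; see cyclic_cutP. *)
Definition cyclic_cut g d :=
  exists H, [/\ subgroup H, finite_index H, H (g ^+ d) &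
    forall m, H (g ^+ m) -> cyclic_subgroup (g ^+ d) (g ^+ m)].

Lemma cyclic_cutP g d : cyclic_cut g d <->
  exists H, [/\ subgroup H, finite_index H &
    cyclic_subgroup g `&` H = cyclic_subgroup (g ^+ d)].
Proof.
split=> -[H].
- move=> [sH fH Hd cut]; exists H; split=> //.
  rewrite eqEsubset; split; last first.
    move=> x cx; split; first exact: cyclic_subgroupX_sub cx.
    exact: cyclic_subgroup_sub cx.
  move=> _ [[[m _ <-]|[m _ <-]] Hm]; first exact: cut.
  apply: cyclic_subgroupV; rewrite invgK; apply: cut.
  by case: sH => _ _ /(_ _ Hm); rewrite invgK.
- move=> [sH fH eH]; exists H; split=> //.
    have : cyclic_subgroup (g ^+ d) (g ^+ d) by left; exists 1%N.
    by rewrite -eH => -[].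
  by move=> m Hm; rewrite -eH; split=> //; apply: cyclic_subgroupXn.
Qed.

Lemma lcoset_eq K x y : subgroup K -> K (x^-1 * y) -> lcoset x K = lcoset y K.
Proof.
move=> [K1 KM KV] Kxy; rewrite eqEsubset; split=> _ [h Kh <-].
- exists (y^-1 * x * h); last by rewrite -!mulgA mulVKg.
  by apply: KM => //; have := KV _ Kxy; rewrite invgM invgK.
- by exists (x^-1 * y * h); [apply: KM | rewrite -!mulgA mulVKg].
Qed.

Lemma mem_lcoset K x y : subgroup K -> lcoset x K y <-> K (x^-1 * y).
Proof.
move=> sK; split=> [[h Kh <-]|Kxy]; first by rewrite mulKg.
by exists (x^-1 * y) => //; rewrite mulVKg.
Qed.

Lemma lcoset_eqP K x y : subgroup K -> lcoset x K = lcoset y K <-> K (x^-1 * y).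
Proof.
move=> sK; split; last exact: lcoset_eq.
move=> e; apply/mem_lcoset => //; rewrite e; apply/mem_lcoset => //.
by rewrite mulVg; case: sK.
Qed.

Lemma subgroupI H K : subgroup H -> subgroup K -> subgroup (H `&` K).
Proof.
move=> [H1 HM HV] [K1 KM KV]; split=> //.
- by move=> x y [? ?] [? ?]; split; [apply: HM | apply: KM].
- by move=> x [? ?]; split; [apply: HV | apply: KV].
Qed.

(** Each coset of the intersection is a coset of [H] intersected with one of [K]. *)
Lemma finite_indexI H K : subgroup H -> subgroup K ->
  finite_index H -> finite_index K -> finite_index (H `&` K).
Proof.
move=> sH sK fH fK; apply: sub_finite_set (finite_image2 setI fH fK).
move=> _ [x _ <-]; exists (lcoset x H); first by exists x.
exists (lcoset x K); first by exists x.
have sHK := subgroupI sH sK; rewrite eqEsubset; split=> y.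
  by move=> [/(mem_lcoset _ _ sH) ? /(mem_lcoset _ _ sK) ?]; apply/mem_lcoset.
by move=> /(mem_lcoset _ _ sHK) [? ?]; split; apply/mem_lcoset.
Qed.

Lemma finite_indexT : finite_index [set: G].
Proof.
apply: (sub_finite_set _ (finite_set1 [set: G])) => _ [x _ <-] /=.
by rewrite eqEsubset; split=> // y _; apply/mem_lcoset.
Qed.

(** One member of the separating family is intersected in for each listed element outside [B]; the
    list is finite, so the index stays finite. *)
Lemma separable_avoid B (s : seq G) : separable B ->
  exists K, [/\ subgroup K, finite_index K, B `<=` K &
    forall a, a \in s -> ~ B a -> ~ K a].
Proof.
move=> [F [FP eB]]; elim: s => [|a s [K [sK fK BK Ks]]].
  by exists [set: G]; split=> //; apply: finite_indexT.
have [Ba|nBa] := pselect (B a).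
  by exists K; split=> // b; rewrite inE => /predU1P[->//|]; apply: Ks.
have [L FL nLa] : exists2 L, F L & ~ L a.
  apply: contrapT => nL; apply: nBa; rewrite eB => L FL.
  by apply: contrapT => nLa; apply: nL; exists L.
have [sL fL] := FP _ FL; exists (K `&` L); split.
- exact: subgroupI.
- exact: finite_indexI.
- by move=> b Bb; split; [apply: BK | move: Bb; rewrite eB; apply].
- move=> b; rewrite inE => /predU1P[->|bs] nBb []//.
  by move=> Kb _; apply: Ks Kb.
Qed.

End Subgroups.

(** * Pulling subgroups back along homomorphisms *)

Section Morphisms.
Variables (G P : groupType) (f : G -> P).
Hypothesis fM : {morph f : x y / x * y}.

Lemma group_morph1 : f 1 = 1.
Proof. by apply: (mulgI (f 1)); rewrite -fM !mulg1. Qed.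

Lemma group_morphV : {morph f : x / x^-1}.
Proof. by move=> x; rewrite (mulg1_eq (y := f x^-1))// -fM mulgV group_morph1. Qed.

Lemma group_morphX n : {morph f : x / x ^+ n}.
Proof.
by move=> x; elim: n => [|n IHn]; rewrite ?group_morph1// !expgS fM IHn.
Qed.

Lemma subgroup_preimage K : subgroup K -> subgroup (f @^-1` K).
Proof.
move=> [K1 KM KV]; split=> [|x y|x] /=.
- by rewrite group_morph1.
- by rewrite fM; apply: KM.
- by rewrite group_morphV; apply: KV.
Qed.

Lemma finite_index_preimage K :
  subgroup K -> finite_index K -> finite_index (f @^-1` K).
Proof.
move=> sK fK; apply: sub_finite_set (finite_image (preimage f) fK).
move=> _ [x _ <-]; exists (lcoset (f x) K); first by exists (f x).
have sfK := subgroup_preimage sK; rewrite eqEsubset; split=> y.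
  move=> /(mem_lcoset _ _ sK) Kxy; apply/(mem_lcoset _ _ sfK).
  by rewrite /= fM group_morphV.
by move=> /(mem_lcoset _ _ sfK) /=; rewrite fM group_morphV => /(mem_lcoset _ _ sK).
Qed.

(** Since [f] is injective on the powers of [g], equalities between powers of [f g] lift, and the
    full preimage cuts at the same exponent. *)
Lemma cyclic_cut_preimage g d :
  (forall m, f g ^+ m = 1 -> g ^+ m = 1) -> cyclic_cut (f g) d -> cyclic_cut g d.
Proof.
move=> fI [K [sK fK Kd cut]]; exists (f @^-1` K); split.
- exact: subgroup_preimage.
- exact: finite_index_preimage.
- by rewrite /= group_morphX.
move=> m /=; rewrite group_morphX => /cut[] [q _].
- rewrite -expgnA => e; left; exists q => //; rewrite -expgnA.
  have eqX a b : (a <= b)%N -> f g ^+ a = f g ^+ b -> g ^+ a = g ^+ b.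
    move=> le_ab eab; have /fI : f g ^+ (b - a) = 1.
      by rewrite expgnFr// eab mulgV.
    by rewrite expgnFr// => /divg1_eq.
  by case/orP: (leq_total (d * q)%N m) => le; [|symmetry]; apply: eqX.
- rewrite -expgnA => e; right; exists q => //; rewrite -expgnA.
  have /fI : f g ^+ (d * q + m) = 1 by rewrite expgnDr -e mulgV.
  by rewrite expgnDr => /mulg1_eq.
Qed.

End Morphisms.

Lemma cyclic_cut_conj (G : groupType) (g x : G) d :
  cyclic_cut (g ^ x) d -> cyclic_cut g d.
Proof.
pose cj := conjg^~ x : G -> G.
have cjM : {morph cj : y z / y * z} by move=> y z; rewrite /cj conjMg.
apply: (cyclic_cut_preimage cjM) => m.
by rewrite /cj -conjXg => /eqP; rewrite conjg_eq1 => /eqP.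
Qed.

Lemma finite_coset_action (A : groupType) (K : set A) :
  subgroup K -> finite_index K ->
  exists (Y : finType) (y0 : Y) (p : A -> {perm Y}),
  {morph p : a b / a * b} /\ forall a, K a <-> p a y0 = y0.
Proof.
move=> sK /finite_fsetP[X eX].
have XP C : reflect (exists x, lcoset x K = C) (C \in X).
  apply: (iffP idP) => [CX|[x <-]].
    by have : [set` X] C := CX; rewrite -eX => -[x _ <-]; exists x.
  by have : [set` X] (lcoset x K) by rewrite -eX; exists x.
(* Permutations compose from left to right, so left translation must be by [a^-1] for [p] to be a
   homomorphism. *)
have inX a (C : X) : [set a^-1 * z | z in val C] \in X.
  apply/XP; have /XP[x <-] := valP C; exists (a^-1 * x).
  by rewrite /lcoset image_comp; apply: eq_imagel => z _ /=; rewrite mulgA.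
pose act a C : X := [` inX a C]%fset.
have actM a b C : act (a * b) C = act b (act a C).
  apply: val_inj => /=; rewrite image_comp; apply: eq_imagel => z _ /=.
  by rewrite invgM mulgA.
have act1 C : act 1 C = C.
  apply: val_inj => /=; rewrite invg1 -[RHS]image_id.
  by apply: eq_imagel => z _ /=; rewrite mul1g.
have actI a : injective (act a).
  by apply: (can_inj (g := act a^-1)) => C; rewrite -actM mulgV act1.
pose p a := perm (@actI a).
have pM : {morph p : a b / a * b}.
  by move=> a b; apply/permP => C; rewrite permM !permE actM.
have KX : lcoset 1 K \in X by apply/XP; exists 1.
exists X, [` KX]%fset, p; split=> // a; rewrite permE.
have -> : (act a [` KX]%fset = [` KX]%fset) <-> lcoset a^-1 K = lcoset 1 K.
  have e : [set a^-1 * z | z in lcoset 1 K] = lcoset a^-1 K.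
    by rewrite /lcoset image_comp; apply: eq_imagel => z _ /=; rewrite mul1g.
  split=> [/(congr1 val)/=|e']; first by rewrite e.
  by apply: val_inj; rewrite /= e.
by rewrite lcoset_eqP// invgK mulg1.
Qed.

(** * Universal property of the amalgamated product *)

Section AmalgamMorphism.
Variables (I : choiceType) (A_ : I -> groupType) (B_ : forall i, set (A_ i)).
Variable phi_ : forall j k, A_ k -> A_ j.
Variables (P : groupType) (f : forall i, A_ i -> P).
Hypothesis fM : forall i, {morph @f i : x y / x * y}.
Hypothesis fB : forall j k (b : A_ k),
  j <> k -> B_ b -> f b = f (phi_ j b).

Definition word_eval (w : word A_) : P :=
  foldr (fun l x => f (tagged l) * x) 1 w.

Lemma word_eval_cat u v : word_eval (u ++ v) = word_eval u * word_eval v.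
Proof. by elim: u => [|l u IHu] /=; rewrite ?mul1g// IHu mulgA. Qed.

Lemma word_eval_cong u v : word_cong u v -> word_eval u = word_eval v.
Proof.
elim=> {u v} [i|i x y|u|u v _ ->|u v w _ -> _ ->|u u' v v' _ uu' _ vv'] //=.
- by rewrite (group_morph1 (@fM i)) mulg1.
- by rewrite fM !mulg1.
- by rewrite !word_eval_cat uu' vv'.
Qed.

Definition free_product_eval (x : free_product A_) : P := word_eval (repr x).

Lemma free_product_eval_class w : free_product_eval (fp_class w) = word_eval w.
Proof. by apply: word_eval_cong; apply/fp_classP; rewrite fp_classK. Qed.

Lemma free_product_evalM : {morph free_product_eval : x y / x * y}.
Proof. by move=> x y; rewrite free_product_eval_class word_eval_cat. Qed.

Lemma free_product_eval_inj i (x : A_ i) : free_product_eval (fp_inj x) = f x.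
Proof. by rewrite free_product_eval_class /= mulg1. Qed.

(** The kernel of the evaluation is a normal subgroup, and by [fB] it contains the relators. *)
Lemma free_product_eval_closure x :
  normal_closure (amalgam_relators B_ phi_) x -> free_product_eval x = 1.
Proof.
move=> Nx; apply: (Nx [set y | free_product_eval y = 1]).
split; first split; first split=> [|y z|y] /=.
- by rewrite (group_morph1 free_product_evalM).
- by rewrite free_product_evalM => -> ->; rewrite mulg1.
- by rewrite (group_morphV free_product_evalM) => ->; rewrite invg1.
- move=> y z /= y1; rewrite !free_product_evalM y1 mul1g.
  by rewrite -free_product_evalM mulVg (group_morph1 free_product_evalM).
- move=> _ [j [k [b [jk Bb ->]]]] /=.
  rewrite free_product_evalM (group_morphV free_product_evalM).
  by rewrite !free_product_eval_inj (fB jk Bb) mulgV.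
Qed.

Lemma amalgam_morphism :
  exists2 h : amalgamated_product B_ phi_ -> P, {morph h : x y / x * y} &
  forall i (x : A_ i), h (quotient_proj _ (fp_inj x)) = f x.
Proof.
pose R := amalgam_relators B_ phi_.
pose h (x : quotient_group R) := free_product_eval (repr x).
have hE x : h (quotient_proj R x) = free_product_eval x.
  have /quotient_projP/free_product_eval_closure :=
    quotient_projK (quotient_proj R x).
  rewrite free_product_evalM (group_morphV free_product_evalM).
  by move/mulg1_eq; rewrite invgK.
exists h => [x y|i x]; last by rewrite hE free_product_eval_inj.
rewrite -[x]quotient_projK -[y]quotient_projK.
by rewrite -[_ * _]quotient_projM !hE free_product_evalM.
Qed.

End AmalgamMorphism.

(** * Permutations moving a base point around a necklace *)

Section Necklace.
Variables (I : eqType) (F : finGroupType) (D : {group F}) (N : nat).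
Variables (idx : 'I_N -> I) (a : 'I_N -> F).
Hypothesis aD : forall t, a t \notin D.
Hypothesis idxS : forall t, idx t != idx (ordS t).
Local Notation X := ('I_N * F)%type.

(* Exchanges the cosets {t + 1} x D and {t} x (a t)D for each t with
   idx t = i; these cosets are pairwise disjoint because a t \notin D. *)
Definition swap i (p : X) : X :=
  if (p.2 \in D) && (idx (ord_pred p.1) == i) then
    (ord_pred p.1, a (ord_pred p.1) * p.2)
  else if (idx p.1 == i) && ((a p.1)^-1 * p.2 \in D) then
    (ordS p.1, (a p.1)^-1 * p.2)
  else p.

Definition rmul x (p : X) : X := (p.1, p.2 * x).

(** As [a t] is outside [D], the image of a point moved by the first branch fails the first test and
    is sent back by the second; the first branch undoes the second. *)
Lemma swapK i : involutive (swap i).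
Proof.
move=> [t f]; rewrite {2}/swap /=.
case: ifP => [/andP[fD it]|nfD].
  rewrite /swap /= groupMr// (negPf (aD _)) /= it mulKg fD /=.
  by rewrite ord_predK.
case: ifP => [/andP[it fD]|nft]; last by rewrite /swap /= nfD nft.
by rewrite /swap /= fD ordSK it /= mulVKg.
Qed.

(** Right multiplication by [d] preserves left cosets of [D], and [swap] acts on second coordinates
    from the left. *)
Lemma swap_rmul i d p : d \in D -> swap i (rmul d p) = rmul d (swap i p).
Proof.
move=> dD; rewrite /swap /rmul /= groupMr// !mulgA groupMr//.
by do 2!case: ifP => _ //=.
Qed.

Lemma twist_inj i x : injective (swap i \o rmul x \o swap i).
Proof.
apply: inj_comp; last exact: inv_inj (swapK i).
apply: inj_comp; first exact: inv_inj (swapK i).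
by move=> [t f] [u g] [-> /mulIg ->].
Qed.

Definition twist i x : {perm X} := perm (@twist_inj i x).

Lemma twistM i : {morph twist i : x y / x * y}.
Proof.
by move=> x y; apply/permP=> p; rewrite permM !permE /= swapK /rmul mulgA.
Qed.

Lemma twistD i j d : d \in D -> twist i d = twist j d.
Proof.
by move=> dD; apply/permP=> p; rewrite !permE /= !swap_rmul// !swapK.
Qed.

(** The inner [swap] fixes [(t, 1)], by [idxS] and [aD]; [rmul] gives [(t, a t)], which the outer
    [swap] carries to [(ordS t, 1)]. *)
Lemma twist_step t : twist (idx t) (a t) (t, 1) = (ordS t, 1).
Proof.
have pt : (idx (ord_pred t) == idx t) = false.
  by apply: negbTE; have := idxS (ord_pred t); rewrite ord_predK.
rewrite permE /= {2}/swap /= pt andbF mulg1 groupV (negPf (aD _)) andbF.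
by rewrite /rmul /= mul1g /swap /= (negPf (aD _)) eqxx mulVg group1.
Qed.

End Necklace.

(** * Words over the factors and cyclic reduction *)

Section Words.
Variables (I : eqType) (A G : groupType) (f : I -> A -> G).
Implicit Types (l : I * A) (w : seq (I * A)).

Definition eval w : G := foldr (fun l x => f l.1 l.2 * x) 1 w.

Lemma eval_cat u v : eval (u ++ v) = eval u * eval v.
Proof. by elim: u => [|l u IHu] /=; rewrite ?mul1g// IHu mulgA. Qed.

Lemma eval_rot n w : exists x, eval (rot n w) = eval w ^ x.
Proof.
exists (eval (take n w)); rewrite /rot eval_cat -{3}(cat_take_drop n w).
by rewrite eval_cat conjgE -mulgA mulKg.
Qed.

(** Ranging over rotations lets the first two letters stand for any cyclically adjacent pair, the
    last and first letters included. *)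
Definition cyclically_reduced (B : set A) w :=
  forall t l l' u, rot t w = [:: l, l' & u] -> ~ B l.2 /\ l.1 != l'.1.

Variable B : set A.
Hypothesis fM : forall i, {morph f i : x y / x * y}.
Hypothesis fB : forall i j b, B b -> f i b = f j b.

(* After a rotation, a letter in B or two adjacent letters from the same factor
   come first and can be merged. *)
Lemma conj_cyclically_reduced w : exists w' x,
  eval w' = eval w ^ x /\ ((size w' <= 1)%N \/ cyclically_reduced B w').
Proof.
have [n le_wn] := ubnP (size w); elim: n w le_wn => // n IHn w.
rewrite ltnS => le_wn.
have [?|nred] := pselect (cyclically_reduced B w).
  by exists w, 1; rewrite conjg1; split; last right.
have [t [[i a] [[j b] [u [ew bad]]]]] : exists t l l' u,
    rot t w = [:: l, l' & u] /\ (B l.2 \/ l.1 = l'.1).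
  apply: contrapT => nex; apply: nred => t l l' u ew; split=> [Bl|].
    by apply: nex; exists t, l, l', u; split; last left.
  by apply/eqP => ll'; apply: nex; exists t, l, l', u; split; last right.
(* A letter in [B] may be read in any factor, so in both cases the pair merges into the factor
   [j]. *)
have fab : f i a * f j b = f j (a * b).
  by rewrite fM; case: bad => [/= Ba|/= ->]//; rewrite (fB i j Ba).
have [y ey] := eval_rot t w.
have [|w' [x [ex red]]] := IHn ((j, a * b) :: u).
  by rewrite -(size_rot t) ew in le_wn.
exists w', (y * x); split=> //.
by rewrite ex conjgM -ey ew /= mulgA fab.
Qed.

End Words.

Lemma stabilizer_finite_index (G : groupType) (X : finType)
    (h : G -> {perm X}) (x0 : X) :
  {morph h : x y / x * y} ->
  subgroup [set x | h x x0 = x0] /\ finite_index [set x | h x x0 = x0].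
Proof.
move=> hM; have sS : subgroup [set s : {perm X} | s x0 = x0].
  split=> [|s t /= sx tx|s /= sx]; first exact: perm1.
    by rewrite permM sx.
  by rewrite -{1}sx permK.
split; first exact: (@subgroup_preimage _ _ h hM _ sS).
apply: (@finite_index_preimage _ _ h hM _ sS); apply: finite_image.
exact: finite_finset.
Qed.

(** * Cutting at a cyclically reduced word *)

Section CyclicallyReduced.
Variables (A G : groupType) (I : eqType) (B : set A) (f : I -> A -> G).
(* The only property of the amalgam used for the finite quotients: morphisms on
   the factors that agree on B extend to G. *)
Hypothesis univ : forall (P : groupType) (e : I -> A -> P),
  (forall i, {morph e i : x y / x * y}) ->
  (forall i j b, B b -> e i b = e j b) ->
  exists2 h : G -> P, {morph h : x y / x * y} & forall i x, h (f i x) = e i x.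
Hypothesis sepB : separable B.

Lemma cyclic_cut_reduced w n : (1 < size w)%N -> (0 < n)%N ->
  cyclically_reduced B w -> cyclic_cut (eval f w) n.
Proof.
move=> w_gt1 n_gt0 redw; set r := size w in w_gt1.
have r_gt0 : (0 < r)%N by apply: ltnW.
have N_gt0 : (0 < n * r)%N by rewrite muln_gt0 n_gt0.
case: w @r w_gt1 r_gt0 N_gt0 redw => // l0 w0; set w := l0 :: w0.
move=> r r_gt1 r_gt0 N_gt0 redw.
(* The word repeated with period [r]. *)
pose c k := nth l0 w (k %% r).
have redc k : ~ B (c k).2 /\ (c k).1 != (c k.+1).1.
  have kr : (k %% r < r)%N by rewrite ltn_mod.
  have c1 : nth l0 (rot (k %% r) w) 0 = c k.
    by rewrite /rot nth_cat size_drop subn_gt0 kr nth_drop addn0.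
  have c2 : nth l0 (rot (k %% r) w) 1 = c k.+1.
    rewrite /rot nth_cat size_drop -/r ltn_subRL addn1 /c -[k.+1]addn1 -modnDml addn1.
    have [lt|] := ltnP (k %% r).+1 r; first by rewrite nth_drop addn1 (modn_small lt).
    (* At the last letter, the successor wraps around to the head of [w]. *)
    rewrite leq_eqVlt ltnS leqNgt kr orbF => /eqP er.
    have -> : (r - k %% r = 1)%N by rewrite {1}er subSnn.
    by rewrite -er modnn nth_take// -ltnS -er.
  have := redw (k %% r); move: c1 c2.
  have := size_rot (k %% r) w; case: (rot _ _) => [|l [|l' u]] /=; rewrite -/r.
  - by [].
  - by move/eqP; rewrite (ltn_eqF r_gt1).
  - by move=> _ <- <- /(_ _ _ _ erefl).
have [K [sK fK BK Kw]] := separable_avoid [seq l.2 | l <- w] sepB.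
have [Y [y0 [p [pM pK]]]] := finite_coset_action sK fK.
pose F : finGroupType := {perm Y}.
(* The stabilizer of the base coset: by [pK], [p x] lies in it exactly when [x] is in [K]. *)
pose Ds : {set F} := finset (fun s : F => s y0 == y0).
have gDs : group_set Ds.
  apply/group_setP; split=> [|s t]; first by rewrite inE perm1.
  by rewrite !inE permM => /eqP-> /eqP->.
pose D : {group F} := group gDs.
have pB b : B b -> p b \in D by move=> /BK/pK e; rewrite inE e.
have pc k : p (c k).2 \notin D.
  have [nB _] := redc k; rewrite inE; apply/eqP => /pK; apply: Kw => //.
  by apply: map_f; apply: mem_nth; rewrite ltn_mod.
(* The necklace holds [n] copies of [w], so [w] must be applied [n] times to close the loop. *)
pose N := (n * r)%N.
pose idx (t : 'I_N) := (c t).1.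
pose a (t : 'I_N) : F := p (c t).2.
have cN k : c (k %% N) = c k by rewrite /c modn_dvdm// dvdn_mull.
have idxS t : idx t != idx (ordS t).
  by rewrite /idx /= cN; case: (redc t).
have aD t : a t \notin D by apply: pc.
have [h hM hf] := univ (e := fun i x => twist idx aD i (p x))
  (fun i x y => etrans (congr1 _ (pM x y)) (twistM idx aD i _ _))
  (fun i j b Bb => twistD idx aD i j (pB b Bb)).
pose pt k : 'I_N * F := (Ordinal (ltn_pmod k N_gt0), 1).
have ptS k : h (f (c k).1 (c k).2) (pt k) = pt k.+1.
  rewrite hf; have := twist_step aD idxS (Ordinal (ltn_pmod k N_gt0)).
  rewrite /idx /a /= cN => ->; congr (_, _); apply: val_inj => /=.
  by rewrite -addn1 modnDml addn1.
have pt_take q j : (j <= r)%N ->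
    h (eval f (take j w)) (pt (q * r)%N) = pt (q * r + j)%N.
  elim: j => [|j IHj] jr; first by rewrite take0 (group_morph1 hM) perm1 addn0.
  (* The leftmost letter acts first, so appending a letter advances the point already reached. *)
  rewrite (take_nth l0)// -cats1 eval_cat hM permM IHj 1?ltnW//= mulg1.
  have -> : nth l0 w j = c (q * r + j)%N.
    by rewrite /c modnMDl modn_small.
  by rewrite ptS addnS.
have ptX m : h (eval f w ^+ m) (pt 0) = pt (m * r)%N.
  elim: m => [|m IHm]; first by rewrite expg0 (group_morph1 hM) perm1.
  rewrite expgSr hM permM IHm -{1}(take_size w) pt_take//.
  by rewrite mulSn addnC.
have ptE m : pt (m * r)%N = pt 0 <-> n %| m.
  rewrite -(@dvdn_pmul2r r)//; split=> [[/eqP]|nm].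
    by rewrite mod0n.
  by congr (_, _); apply: val_inj; rewrite /= mod0n; apply/eqP.
have [sH fH] := stabilizer_finite_index (pt 0) hM.
exists [set x | h x (pt 0) = pt 0]; split=> //=.
  by rewrite ptX; apply/ptE.
by move=> m; rewrite ptX => /ptE/dvdnP[q ->]; rewrite mulnC expgnA;
  apply: cyclic_subgroupXn.
Qed.

End CyclicallyReduced.

(** * Quasipotency of the amalgam, by the length of the reduced word *)

Theorem theorem1
  (A : groupType) (B : set A)
  (I : finType) (A_ : I -> groupType)
  (phi : forall i, {multiplicative A -> A_ i})
  (phiV : forall i, A_ i -> A)
  (phiK : forall i, cancel (phi i) (phiV i))
  (phiVK : forall i, cancel (phiV i) (phi i)) :
  quasipotent A -> subgroup B -> separable B ->
  quasipotent (amalgamated_product (fun i => [set phi i b | b in B])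
                                   (fun j k => phi j \o phiV k)).
Proof.
move=> qA _ sepB; set G := amalgamated_product _ _.
pose R := amalgam_relators (fun i => [set phi i b | b in B])
                           (fun j k => phi j \o phiV k).
pose f i (x : A) : G := quotient_proj R (fp_inj (phi i x)).
have fM i : {morph f i : x y / x * y}.
  by move=> x y; rewrite /f gmulfM gmulfM gmulfM.
have phiVM i : {morph phiV i : x y / x * y}.
  by move=> x y; apply: (canLR (phiK i)); rewrite gmulfM !phiVK.
have fB i j b : B b -> f i b = f j b.
  move=> Bb; have [->//|/eqP ij] := eqVneq i j.
  apply/quotient_projP => M [[[_ _ MV] MJ] RM].
  (* The inverse of this relator, conjugated by the image of [phi j b], is the quotient tested by
     [quotient_projP]. *)
  have /MV : M (fp_inj (phi i b) * (fp_inj (phi j b))^-1).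
    apply: RM; exists j, i, (phi i b); split; first by move/esym.
      by exists b.
    by rewrite /= phiK.
  rewrite invgM invgK => /(MJ _ (fp_inj (phi j b))).
  by rewrite -mulgA mulKg.
have univ (P : groupType) (e : I -> A -> P) :
    (forall i, {morph e i : x y / x * y}) ->
    (forall i j b, B b -> e i b = e j b) ->
    exists2 h : G -> P, {morph h : x y / x * y} &
      forall i x, h (f i x) = e i x.
  move=> eM eB.
  have [|j k x _ [b Bb <-]|h hM hE] := @amalgam_morphism I A_
      (fun i => [set phi i b | b in B]) (fun j k => phi j \o phiV k) P
      (fun i x => e i (phiV i x)).
  - by move=> i x y; rewrite phiVM eM.
  - by rewrite /= !phiK; apply: eB.
  - by exists h => // i x; rewrite hE phiK.
have feval (g : G) : exists w, eval f w = g.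
  rewrite -[g](@quotient_projK _ R) -[repr g]fp_classK.
  elim: (repr _) => [|[i x] u [w ew]]; first by exists [::].
  exists ((i, phiV i x) :: w) => /=; rewrite ew /f phiVK -gmulfM.
  by congr quotient_proj; apply: esym (fp_class_cat [:: letter_of x] u).
move=> g; have [w ew] := feval g.
have [w' [x [ew' red]]] := conj_cyclically_reduced fM fB w.
suff [k k0 kn] : exists2 k, (0 < k)%N & forall n, (0 < n)%N ->
    cyclic_cut (eval f w') (k * n).
  exists k => // n n0; apply/cyclic_cutP; apply: (@cyclic_cut_conj _ g x).
  by rewrite -ew -ew'; apply: kn.
case: w' {ew'} red => [|[i a] [|l w']] red.
- exists 1%N => // n _; apply/cyclic_cutP; exists setT; split=> //.
    exact: finite_indexT.
  by rewrite /= expg1n setIT.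
(* Identity maps on all factors fold [G] onto [A]; [h] is injective on each factor, so the exponent
   [k] of [a] in [A] serves. *)
- have [h hM hf] := univ A (fun _ => id) (fun _ _ _ => erefl)
                           (fun _ _ _ _ => erefl).
  have [k k0 kn] := qA a; exists k => // n n0 /=; rewrite mulg1.
  apply: (cyclic_cut_preimage hM) => [m|]; rewrite hf; last exact/cyclic_cutP/kn.
  by rewrite -(group_morphX (fM i)) => ->; rewrite (group_morph1 (fM i)).
- exists 1%N => // n n0; rewrite mul1n.
  by apply: (cyclic_cut_reduced univ) => //; case: red.
Qed.
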